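(* Assume the continuum hypothesis ($2^{\aleph_0}=\aleph_1$). Then there exist a group $G$ and a subset $A\subset G$ such that $A$ is unconditionally closed in $G$ but $A$ is not algebraic in $G$.
   Context: Let $G$ be a group with identity element $1$. A subset $A\subset G$ is unconditionally closed in $G$ if it is closed in every Hausdorff group topology on $G$. A subset $A\subset G$ is elementary algebraic in $G$ if there is a word $w=w(x)$ in the alphabet $G\cup\{x^{\pm1}\}$ ($x$ is a variable) such that $A=\{x\in G: w(x)=1\}$. Finite unions of elementary algebraic sets are called additively algebraic, and arbitrary intersections of additively algebraic sets are called algebraic. *)

(* Defs.v *)
From HB Require Import structures.
From mathcomp Require Import all_boot.
From mathcomp Require Import boolp classical_sets functions cardinality.
From mathcomp Require Import filter topology.

Set Implicit Arguments.
Unset Strict Implicit.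
Unset Printing Implicit Defensive.

Local Open Scope classical_set_scope.
Local Open Scope card_scope.
Local Open Scope group_scope.

(* The cardinality of A is aleph_1, i.e. the least uncountable cardinal. *)
Definition card_aleph1 (T : Type) (A : set T) : Prop :=
  ~ countable A /\
  forall (U : Type) (B : set U), ~ countable B -> A #<= B.

Definition continuum_hypothesis : Prop := card_aleph1 [set: set nat].

Section UnconditionallyClosed.
Variable G : groupType.

(* The HB class [Topological G] packs a topology on the carrier of G (together
   with eqType and choiceType data, which carry no information);
   [with_topology tau] is the carrier of G endowed with the topology tau. *)
Definition with_topology (tau : Topological G) : topologicalType :=
  Topological.Pack tau.

Definition is_group_topology (tau : Topological G) : Prop :=
  let T := with_topology tau in
  continuous ((fun p => (p.1 : G) * (p.2 : G)) : T * T -> T) /\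
  continuous ((fun x => (x : G)^-1) : T -> T).

Definition unconditionally_closed (A : set G) : Prop :=
  forall tau : Topological G,
    is_group_topology tau -> hausdorff_space (with_topology tau) ->
    closed (A : set (with_topology tau)).

End UnconditionallyClosed.

Inductive letter (G : Type) : Type :=
  | LConst of G
  | LVar
  | LVarInv.
Arguments LVar {G}.
Arguments LVarInv {G}.

Section Algebraic.
Variable G : groupType.

Definition letter_eval (x : G) (l : letter G) : G :=
  match l with
  | LConst g => g
  | LVar => x
  | LVarInv => x^-1
  end.

Definition word_eval (w : seq (letter G)) (x : G) : G :=
  \prod_(l <- w) letter_eval x l.

Definition elementary_algebraic (A : set G) : Prop :=
  exists w : seq (letter G), A = [set x | word_eval w x = 1].

(* The empty union is allowed: otherwise the empty subset of the trivial group
   would fail to be algebraic. *)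
Definition additively_algebraic (A : set G) : Prop :=
  exists F : set (set G),
    [/\ finite_set F, F `<=` elementary_algebraic & A = \bigcup_(B in F) B].

Definition algebraic (A : set G) : Prop :=
  exists F : set (set G),
    F `<=` additively_algebraic /\ A = \bigcap_(B in F) B.

End Algebraic.

(* Main.v *)
Require Import Defs.
From HB Require Import structures.
From mathcomp Require Import all_boot all_algebra order.
From mathcomp Require Import boolp classical_sets cardinality.
From mathcomp Require Import finmap monalg filter topology.

Set Implicit Arguments.
Unset Strict Implicit.
Unset Printing Implicit Defensive.

Import GRing.Theory Num.Theory Order.TTheory.
Local Open Scope ring_scope.

(** Let M be the rational vector space with basis e_n (n natural) and f_phi
    (phi : nat -> nat), let V be the F_2-vector space with basis M x nat, and let
    the affine maps x |-> 2^j x + b of M act on V.  An invariant bilinear form on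
    V turns V x F_2 into a group of exponent 4 with central element g = (0, 1),
    and G is the semidirect product of this group with the affine maps.  The form
    is chosen so that, if x and y in V are supported over 0 in M, with
    coordinates x_m and y_m, then the conjugates of x by the translation e_n and
    of y by the translation f_phi have commutator g^(x_(phi n) y_n).

    Let A be the set of all (v, z) with v nonzero supported over 0.  The union
    of A and the subgroup {1, g} is the set of solutions of two equations:
    commuting with x |-> 2x, and x^4 = 1.  So A can fail to be closed only if 1
    lies in its closure.  In that case take neighbourhoods P, Q of 1 such that g
    is not a commutator of elements of P and Q.  For each n the conjugate by e_n
    of some x in A is in P; choose phi n with x_(phi n) = 1.  The conjugate by
    f_phi of some y in A is in Q, and y_n = 1 for some n; then g is such a
    commutator, a contradiction.

    A is not algebraic: finitely many words involve finitely many elements of G.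
    For all but finitely many l, deleting the l-th coordinates is a homomorphism
    on a subgroup containing these elements; it fixes them, and it sends the
    basis vector x = (0, l) in A to 1.  So w(x) = 1 implies w(1) = 1 for each of
    the words w, although 1 is not in A. *)

(** * Linear extension of maps defined on a basis *)

Section FreeExtension.
Context {R : comNzRingType} {K : choiceType} {W : lmodType R}.
Implicit Types (f : K -> W) (v : {malg R[K]}).

Definition free_ext f v : W := \sum_(k <- msupp v) v@_k *: f k.

Lemma free_extEw f (d : {fset K}) v : (msupp v `<=` d)%fset ->
  free_ext f v = \sum_(k <- d) v@_k *: f k.
Proof.
move=> vd; rewrite /free_ext (big_fset_incl _ vd) //= => k _ /mcoeff_outdom ->.
by rewrite scale0r.
Qed.

Lemma free_ext_is_linear f : linear (free_ext f).
Proof.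
move=> c u v; pose d := (msupp u `|` msupp v)%fset.
have du : (msupp u `<=` d)%fset by exact: fsubsetUl.
have dv : (msupp v `<=` d)%fset by exact: fsubsetUr.
have duv : (msupp (c *: u + v) `<=` d)%fset.
  apply: fsubset_trans (msuppD_le _ _) _.
  by rewrite fsubUset dv andbT (fsubset_trans (msuppZ_le _ _)).
rewrite !(free_extEw f (d := d)) // scaler_sumr -big_split /=.
by apply: eq_bigr => k _; rewrite mcoeffD mcoeffZ scalerDl scalerA.
Qed.

HB.instance Definition _ f :=
  GRing.isLinear.Build R {malg R[K]} W *:%R (free_ext f) (free_ext_is_linear f).

Lemma free_extU f k : free_ext f << k >> = f k.
Proof.
rewrite (free_extEw f (d := [fset k]%fset)) ?msuppU_le //.
by rewrite big_seq_fset1 mcoeffUU scale1r.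
Qed.

Lemma eq_free_ext f g v : {in msupp v, f =1 g} -> free_ext f v = free_ext g v.
Proof. by move=> fg; apply: eq_big_seq => k /fg ->. Qed.

Lemma free_extD f g v :
  free_ext (fun k => f k + g k) v = free_ext f v + free_ext g v.
Proof.
by rewrite /free_ext -big_split; apply: eq_bigr => k _ /=; rewrite scalerDr.
Qed.

Lemma free_extZ c f v : free_ext (fun k => c *: f k) v = c *: free_ext f v.
Proof.
by rewrite /free_ext scaler_sumr; apply: eq_bigr => k _; rewrite !scalerA mulrC.
Qed.

End FreeExtension.

Lemma free_ext_comp (R : comNzRingType) (K : choiceType) (U W : lmodType R)
    (g : {linear U -> W}) (f : K -> U) v :
  g (free_ext f v) = free_ext (g \o f) v.
Proof.
by rewrite /free_ext linear_sum; apply: eq_bigr => k _; rewrite linearZ.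
Qed.

Lemma free_ext_id (R : comNzRingType) (K : choiceType) (v : {malg R[K]}) :
  free_ext (fun k => << k >>) v = v.
Proof.
rewrite [RHS]monalgE; apply: eq_bigr => k _.
by apply/malgP => i; rewrite mcoeffZ !mcoeffU mulr_natr.
Qed.

Lemma mcoeff_free_ext (R : comNzRingType) (K H : choiceType)
    (f : K -> {malg R[H]}) v h :
  (free_ext f v)@_h = free_ext (fun k => (f k)@_h : R^o) v.
Proof.
rewrite /free_ext raddf_sum; apply: eq_bigr => k _.
by rewrite /= mcoeffZ.
Qed.

Lemma free_ext_delta (R : comNzRingType) (K : choiceType) (v : {malg R[K]}) k :
  free_ext (fun i => (i == k)%:R : R^o) v = v@_k.
Proof.
rewrite -[in RHS](free_ext_id v) mcoeff_free_ext.
by apply: eq_free_ext => i _; rewrite mcoeffU.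
Qed.

(** * The space V, the affine action on it and the invariant form *)

(** [inl n] stands for the basis vector e_n of M, and [inr phi] for f_phi. *)
Definition vertex : Type := (nat + (nat -> nat))%type.
HB.instance Definition _ := Choice.on vertex.

Definition shift_module : Type := {malg rat[vertex]}.
HB.instance Definition _ := GRing.Lmodule.on shift_module.

Definition site : Type := (shift_module * nat)%type.
HB.instance Definition _ := Choice.on site.

(** [bool] serves as the field F_2: addition is exclusive or, multiplication is conjunction. *)
Definition site_space : Type := {malg bool[site]}.
HB.instance Definition _ := GRing.Lmodule.on site_space.

Definition row (n : nat) : shift_module := << (inl n : vertex) >>.
Definition column (phi : nat -> nat) : shift_module := << (inr phi : vertex) >>.

Definition two_pow (j : int) : rat := 2%:R ^ j.

Lemma two_pow_gt0 j : 0 < two_pow j.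
Proof. by rewrite exprz_gt0. Qed.

Lemma two_pow_neq0 j : two_pow j != 0.
Proof. by rewrite lt0r_neq0 ?two_pow_gt0. Qed.

Lemma two_powD i j : two_pow (i + j) = two_pow i * two_pow j.
Proof. by rewrite /two_pow expfzDr. Qed.

Lemma two_pow0 : two_pow 0 = 1.
Proof. by []. Qed.

Lemma two_powN j : two_pow (- j) = (two_pow j)^-1.
Proof. by rewrite /two_pow -invr_expz. Qed.

Definition act_site (j : int) (b : shift_module) (s : site) : site :=
  (two_pow j *: s.1 + b, s.2).

Lemma act_site_comp i j a b s :
  act_site i a (act_site j b s) = act_site (i + j) (a + two_pow i *: b) s.
Proof.
by rewrite /act_site /= two_powD scalerDr scalerA -addrA [a + _]addrC.
Qed.

Lemma act_site0 s : act_site 0 0 s = s.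
Proof. by case: s => p m; rewrite /act_site two_pow0 scale1r addr0. Qed.

Definition act_space (j : int) (b : shift_module) : site_space -> site_space :=
  free_ext (fun s => << act_site j b s >> : site_space).
HB.instance Definition _ j b := GRing.Linear.on (act_space j b).

Lemma act_spaceD j b v w :
  act_space j b (v + w) = act_space j b v + act_space j b w.
Proof. exact: linearD. Qed.

Lemma act_spaceN j b v : act_space j b (- v) = - act_space j b v.
Proof. exact: linearN. Qed.

Lemma act_spaceVec0 j b : act_space j b 0 = 0.
Proof. exact: linear0. Qed.

Lemma act_spaceU j b s : act_space j b << s >> = << act_site j b s >>.
Proof. exact: free_extU. Qed.

Lemma act_space_comp i j a b v :
  act_space i a (act_space j b v) = act_space (i + j) (a + two_pow i *: b) v.
Proof.
rewrite {2}/act_space free_ext_comp; apply: eq_free_ext => s _ /=.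
by rewrite act_spaceU act_site_comp.
Qed.

Lemma act_space0 v : act_space 0 0 v = v.
Proof.
rewrite -[RHS]free_ext_id; apply: eq_free_ext => s _.
by rewrite act_site0.
Qed.

Lemma act_site_inj j b : injective (act_site j b).
Proof.
move=> [p m] [q n] /pair_equal_spec /= [eq_pq ->]; congr (_, _).
have /(congr1 (fun x => (two_pow j)^-1 *: x)) := addIr _ eq_pq.
by rewrite !scalerA mulVf ?two_pow_neq0 // !scale1r.
Qed.

Lemma mcoeff_act_space j b v s : (act_space j b v)@_(act_site j b s) = v@_s.
Proof.
rewrite /act_space mcoeff_free_ext -[RHS]free_ext_delta.
apply: (eq_free_ext (W := bool^o)) => t _.
by rewrite mcoeffU (inj_eq (@act_site_inj j b)).
Qed.

(* In characteristic 2 the form must be non-symmetric for commutators to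
   be nontrivial: the factor [two_pow j] is positive, so [linked s t] and
   [linked t s] exclude each other. *)
Definition linked (s t : site) : Prop :=
  exists j phi, t.1 - s.1 = two_pow j *: (column phi - row t.2)
    /\ s.2 = phi t.2.

(** Translations preserve t.1 - s.1, and dilations scale it by a power of 2, which the existential
    exponent in [linked] absorbs. *)
Lemma linked_act j b s t :
  linked (act_site j b s) (act_site j b t) <-> linked s t.
Proof.
have ne := two_pow_neq0 j.
rewrite /linked /=; split=> -[i [phi [eq_st eq_m]]].
  exists (i - j), phi; split=> //.
  rewrite two_powD two_powN [_ * _^-1]mulrC -scalerA -eq_st.
  by rewrite opprD addrACA subrr addr0 -scalerBr scalerA mulVf // scale1r.
exists (j + i), phi; split=> //.
by rewrite two_powD -scalerA -eq_st opprD addrACA subrr addr0 scalerBr.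
Qed.

Definition pairing (v w : site_space) : bool :=
  free_ext
    (fun s => free_ext (fun t => `[< linked s t >] : bool^o) w : bool^o) v.

Lemma pairingDl u v w : pairing (u + v) w = pairing u w + pairing v w.
Proof. exact: (linearD (free_ext (W := bool^o) _)). Qed.

Lemma pairingDr u v w : pairing u (v + w) = pairing u v + pairing u w.
Proof.
rewrite -[RHS](free_extD (W := bool^o)).
apply: (eq_free_ext (W := bool^o)) => s _.
exact: (linearD (free_ext (W := bool^o) _)).
Qed.

Lemma pairing_act j b v w :
  pairing (act_space j b v) (act_space j b w) = pairing v w.
Proof.
rewrite /pairing {1}/act_space (free_ext_comp (W := bool^o)).
apply: (eq_free_ext (W := bool^o)) => s _ /=.
rewrite free_extU /act_space (free_ext_comp (W := bool^o)).
apply: (eq_free_ext (W := bool^o)) => t _ /=.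
by rewrite free_extU; apply/asbool_equiv_eq/linked_act.
Qed.

(** * The group G *)

(** An element is the product, in this order, of the pair ([vec], [central]) and the affine map with
    data [dilation], [translation]. *)
Record elt := Elt {
  dilation : int;
  translation : shift_module;
  vec : site_space;
  central : bool }.

Definition tuple_of_elt x := (dilation x, translation x, vec x, central x).
Definition elt_of_tuple x := Elt x.1.1.1 x.1.1.2 x.1.2 x.2.

Lemma tuple_of_eltK : cancel tuple_of_elt elt_of_tuple.
Proof. by case. Qed.

HB.instance Definition _ := Choice.copy elt (can_type tuple_of_eltK).

Lemma elt_eq j j' b b' v v' z z' :
  j = j' -> b = b' -> v = v' -> z = z' -> Elt j b v z = Elt j' b' v' z'.
Proof. by move=> -> -> -> ->. Qed.

Definition elt_one := Elt 0 0 0 0.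

Definition elt_mul x y :=
  let v := act_space (dilation x) (translation x) (vec y) in
  Elt (dilation x + dilation y)
      (translation x + two_pow (dilation x) *: translation y)
      (vec x + v)
      (central x + central y + pairing (vec x) v).

(** The term [pairing (vec x) (vec x)] compensates the value of the form that appears when [x] is
    multiplied by its inverse. *)
Definition elt_inv x :=
  let j := - dilation x in
  let b := - (two_pow j *: translation x) in
  Elt j b (- act_space j b (vec x)) (- central x + pairing (vec x) (vec x)).

Lemma pairing0l v : pairing 0 v = 0.
Proof. exact: (linear0 (free_ext (W := bool^o) _)). Qed.

Lemma pairingNl v w : pairing (- v) w = - pairing v w.
Proof. exact: (linearN (free_ext (W := bool^o) _)). Qed.

Lemma pairing0r v : pairing v 0 = 0.
Proof. by apply: (addIr (pairing v 0)); rewrite -pairingDr !add0r. Qed.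

Lemma pairingNr v w : pairing v (- w) = - pairing v w.
Proof. by apply: (addIr (pairing v w)); rewrite -pairingDr !addNr pairing0r. Qed.

(** A bilinear form is a 2-cocycle, and its invariance makes the affine maps act by automorphisms of
    the extension. The central coordinate then reduces to an identity over F_2, checked by cases. *)
Lemma elt_mulA : associative elt_mul.
Proof.
move=> [i a u x] [j b v y] [k c w z]; apply: elt_eq => /=.
- exact: addrA.
- by rewrite two_powD scalerDr scalerA addrA.
- by rewrite act_spaceD act_space_comp addrA.
- rewrite -(act_space_comp i j) act_spaceD pairingDl pairingDr pairing_act.
  move: (pairing v _) (pairing u _) (pairing u _) => p q r.
  by case: x y z p q r => [] [] [] [] [] [].
Qed.

Lemma elt_mul1 : left_id elt_one elt_mul.
Proof.
move=> [j b v z]; rewrite /elt_mul /elt_one /=.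
by rewrite !act_space0 two_pow0 scale1r !add0r pairing0l addr0.
Qed.

Lemma elt_mulr1 : right_id elt_one elt_mul.
Proof.
move=> [j b v z]; rewrite /elt_mul /elt_one /=.
by rewrite act_spaceVec0 scaler0 pairing0r !addr0.
Qed.

Lemma elt_mulV : left_inverse elt_one elt_inv elt_mul.
Proof.
move=> [j b v z]; rewrite /elt_mul /elt_inv /elt_one /=; congr Elt.
- exact: addNr.
- exact: addNr.
- exact: addNr.
- by rewrite pairingNl pairing_act; case: (pairing v v) z => [] [].
Qed.

Lemma elt_mulrV : right_inverse elt_one elt_inv elt_mul.
Proof.
move=> [j b v z]; rewrite /elt_mul /elt_inv /elt_one /= act_spaceN.
rewrite act_space_comp scalerN scalerA -two_powD !subrr two_pow0 scale1r subrr.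
rewrite act_space0.
congr Elt; first exact: subrr.
by rewrite pairingNr addrA subrr add0r subrr.
Qed.

HB.instance Definition _ := isGroup.Build elt
  elt_mulA elt_mul1 elt_mulr1 elt_mulV elt_mulrV.

(** * Hausdorff group topologies *)

Section GroupTopology.
Local Open Scope group_scope.
Local Open Scope classical_set_scope.
Variables (G : groupType) (tau : Topological G).
Hypothesis group_tau : is_group_topology tau.
Local Notation T := (with_topology tau).

Lemma continuous_mul (X : topologicalType) (f g : X -> T) :
  continuous f -> continuous g ->
  continuous ((fun x => (f x : G) * (g x : G)) : X -> T).
Proof.
move=> cf cg x.
have := @cvg_comp _ _ _ (fun y => (f y, g y))
  (fun p : T * T => ((p.1 : G) * (p.2 : G)) : T) (nbhs x) _ _ _
  (group_tau.1 (f x, g x)).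
by apply; apply: cvg_pair; [exact: cf|exact: cg].
Qed.

Lemma continuous_inv (X : topologicalType) (f : X -> T) :
  continuous f -> continuous ((fun x => (f x : G)^-1) : X -> T).
Proof.
move=> cf x.
exact: (@cvg_comp _ _ _ f (fun y : T => (y : G)^-1 : T) (nbhs x) _ _ (cf x)
  (group_tau.2 (f x))).
Qed.

Lemma continuous_word_eval (w : seq (letter G)) :
  continuous (word_eval w : T -> T).
Proof.
elim: w => [|l w IHw].
  rewrite (_ : word_eval [::] = fun=> 1).
    exact: (@cst_continuous T T).
  by apply/funext => x; rewrite /word_eval big_nil.
rewrite (_ : word_eval (l :: w) = fun x => letter_eval x l * word_eval w x).
  apply: continuous_mul IHw; case: l => [g||] /=.
  - exact: (@cst_continuous T T).
  - by move=> x; exact: cvg_id.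
  - by apply: (@continuous_inv T id) => x; exact: cvg_id.
by apply/funext => x; rewrite /word_eval big_cons.
Qed.

Hypothesis hausdorff_tau : hausdorff_space T.

Lemma closed_singleton (x : T) : closed [set x].
Proof. exact/accessible_closed_set1/hausdorff_accessible. Qed.

Lemma elementary_algebraic_closed (A : set G) :
  elementary_algebraic A -> closed (A : set T).
Proof.
move=> [w ->].
apply: (@preimage_closed T T (word_eval w) [set (1 : T)]).
  by move=> x _; exact: continuous_word_eval.
exact: closed_singleton.
Qed.

Lemma conjugation_nbhs1 (h : G) (P : set T) :
  nbhs (1 : T) P -> nbhs (1 : T) [set x : T | P (h * (x : G) * h^-1)].
Proof.
move=> nP.
have cf : continuous ((fun x => h * (x : G) * h^-1) : T -> T).
  apply: continuous_mul; last exact: (@cst_continuous T T).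
  by apply: continuous_mul => [|x];
    [exact: (@cst_continuous T T)|exact: cvg_id].
by apply: (cf (1 : T)); rewrite mulg1 mulgV.
Qed.

Lemma closure_translate (g : G) (A : set T) (y : T) :
  closure A y -> closure [set x : T | A (g * (x : G))] (g^-1 * (y : G)).
Proof.
move=> clA B nB.
have cf : continuous ((fun x => g^-1 * (x : G)) : T -> T).
  by apply: continuous_mul => [|x];
    [exact: (@cst_continuous T T)|exact: cvg_id].
have [x [Ax Bx]] := clA _ (cf y _ nB).
by exists (g^-1 * (x : G)); split=> //=; rewrite mulVKg.
Qed.

(** The commutator map is continuous and takes the value 1 at (1, 1), and the complement of {g} is
    an open neighbourhood of 1. *)
Lemma commutator_avoiding (g : G) : g <> 1 ->
  exists P Q : set T, [/\ nbhs (1 : T) P, nbhs (1 : T) Q &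
    forall x y : G, P x -> Q y -> x * y * x^-1 * y^-1 <> g].
Proof.
move=> g1.
have cfst : continuous (fst : T * T -> T) by move=> x; exact: cvg_fst.
have csnd : continuous (snd : T * T -> T) by move=> x; exact: cvg_snd.
have cf : continuous ((fun p => (p.1 : G) * (p.2 : G) * (p.1 : G)^-1
    * (p.2 : G)^-1) : T * T -> T).
  apply: continuous_mul (continuous_inv csnd).
  apply: continuous_mul (continuous_inv cfst).
  exact: continuous_mul cfst csnd.
have ng : nbhs (1 : T) (~` [set g] : set T).
  apply: open_nbhs_nbhs; split; last by move=> eq1; apply: g1.
  exact/closed_openC/closed_singleton.
have f1 : (1 : G) * 1 * 1^-1 * 1^-1 = 1 by rewrite !mulg1 mulgV mul1g invg1.
have [] := cf ((1 : T), (1 : T)) (~` [set g]); first by rewrite /= f1.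
move=> [P Q] /= [nP nQ] PQ; exists P, Q; split=> // x y Px Qy.
exact: (PQ (x, y)).
Qed.

End GroupTopology.

(** * The set A and vectors fixed by doubling *)

Definition at_origin (v : site_space) : Prop := forall s, v@_s != 0 -> s.1 = 0.

Definition base v z : elt := Elt 0 0 v z.
Definition dilate : elt := Elt 1 0 0 0.
Definition shift (b : shift_module) : elt := Elt 0 b 0 0.

Definition nontrivial_base : set elt :=
  [set x | exists v z, [/\ x = base v z, at_origin v & v <> 0]].

Lemma site_spaceDD (v : site_space) : v + v = 0.
Proof. by apply/malgP => s; rewrite mcoeffD mcoeff0; case: (v@_s). Qed.

Lemma two_pow_inj : injective (two_pow \o Posz).
Proof. by move=> m n; apply: ieexprIn. Qed.

(* The orbits of [x |-> 2 x] outside 0 are infinite. *)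
Lemma dilate_fixed v : act_space 1 0 v = v <-> at_origin v.
Proof.
split=> [fix_v [p m]|org_v]; last first.
  rewrite -[RHS]free_ext_id; apply: eq_free_ext => -[p m].
  rewrite -mcoeff_neq0 => /org_v /= ->.
  by rewrite /act_site scaler0 addr0.
move=> vpm /=; have [//|p0] := eqVneq p 0; exfalso.
have orbit k : v@_(two_pow (Posz k) *: p, m) = v@_(p, m).
  elim: k => [|k IHk]; first by rewrite two_pow0 scale1r.
  rewrite -IHk -[RHS](mcoeff_act_space 1 0) fix_v.
  by rewrite /act_site addr0 scalerA -two_powD.
pose orb k := (two_pow (Posz k) *: p, m) : site.
have orb_inj : injective orb.
  move=> i j /(congr1 fst) /= eq_ij; apply: two_pow_inj => /=; apply/eqP.
  rewrite -subr_eq0; have /eqP := eq_ij.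
  by rewrite -subr_eq0 -scalerBl scaler_eq0 (negPf p0) orbF.
pose n := size (enum_fset (msupp v)).
have : (size (map orb (iota 0 n.+1)) <= n)%N.
  apply: uniq_leq_size; first by rewrite map_inj_uniq ?iota_uniq.
  by move=> _ /mapP[k _ ->]; rewrite -/(_ \in msupp v) -mcoeff_neq0 orbit.
by rewrite size_map size_iota ltnn.
Qed.

(** * The form on translates of vectors supported over 0 *)

Lemma linked_row_column n phi m l :
  linked (row n, m) (column phi, l) <-> m = phi n /\ l = n.
Proof.
rewrite /linked /=; split=> [[j [psi [eq_np ->]]]|[-> ->]]; last first.
  by exists 0, phi; rewrite two_pow0 scale1r.
have ne := two_pow_neq0 j.
have := congr1 (fun b : shift_module => b@_(inr phi : vertex)) eq_np.
have := congr1 (fun b : shift_module => b@_(inl n : vertex)) eq_np.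
rewrite !(mcoeffZ, mcoeffB, mcoeffU) !eqxx /= !sub0r !subr0 mulr1n.
(* If l differs from n, the coefficient of e_n gives -1 = 0; below, the coefficient of f_phi
   excludes psi different from phi in the same way. *)
case: (inl l == inl n :> vertex) / eqP => [[->] _|_]; last first.
  by move/eqP; rewrite oppr0 mulr0 oppr_eq0 => /eqP.
case: (inr psi == inr phi :> vertex) / eqP => [[->] _|_] //.
by rewrite mulr0 => /eqP.
Qed.

(** The coefficient of e_n is 1 on one side and, since powers of 2 are positive, at most 0 on the
    other. *)
Lemma linked_column_row n phi m l : ~ linked (column phi, l) (row n, m).
Proof.
rewrite /linked /= => -[j [psi [eq_np _]]].
have := congr1 (fun b : shift_module => b@_(inl n : vertex)) eq_np.
rewrite !(mcoeffZ, mcoeffB, mcoeffU) !eqxx /= !subr0 sub0r mulrN => eq1.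
have : (0 : rat) < 1 by []; rewrite -(mulr1n 1) eq1 oppr_gt0 ltNge.
by rewrite mulr_ge0 ?ler0n // ltW ?two_pow_gt0.
Qed.

Lemma free_ext_pick (K : choiceType) (f : K -> bool^o) (v : {malg bool[K]}) c k :
  {in msupp v, forall i, f i = c * (i == k)%:R} -> free_ext f v = c * v@_k.
Proof.
move=> fE; rewrite (eq_free_ext (g := fun i => c *: ((i == k)%:R : bool^o))) //.
by rewrite free_extZ free_ext_delta.
Qed.

(** Over 0 the translations move each site (0, m) to (a, m) or (b, m), so only the second components
    remain as variables in the double sum. *)
Lemma pairing_act_origin a b (h : nat -> nat -> bool) v w :
  (forall m l, `[< linked (a, m) (b, l) >] = h m l) ->
  at_origin v -> at_origin w ->
  pairing (act_space 0 a v) (act_space 0 b w) =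
    free_ext (fun s => free_ext (fun t => h s.2 t.2 : bool^o) w : bool^o) v.
Proof.
move=> hE org_v org_w.
rewrite /pairing {1}/act_space (free_ext_comp (W := bool^o)).
apply: (eq_free_ext (W := bool^o)) => -[p m] /=.
rewrite -mcoeff_neq0 => /org_v /= ->.
rewrite free_extU /act_space (free_ext_comp (W := bool^o)).
apply: (eq_free_ext (W := bool^o)) => -[q l] /=.
rewrite -mcoeff_neq0 => /org_w /= ->.
by rewrite free_extU /act_site /= !scaler0 !add0r.
Qed.

Lemma pairing_row_column n phi v w : at_origin v -> at_origin w ->
  pairing (act_space 0 (row n) v) (act_space 0 (column phi) w)
    = v@_(0, phi n) * w@_(0, n).
Proof.
(* The outer sum runs over [v]; the inner one supplies its constant factor [w@_(0, n)], hence the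
   swap. *)
move=> org_v org_w; rewrite mulrC.
rewrite (pairing_act_origin (h := fun m l => (m == phi n) && (l == n))) //.
  apply: free_ext_pick => -[p m]; rewrite -mcoeff_neq0 => /org_v /= ->.
  rewrite xpair_eqE eqxx mulrC /=.
  apply: free_ext_pick => -[q l]; rewrite -mcoeff_neq0 => /org_w /= ->.
  by rewrite xpair_eqE eqxx /=; case: (m == _); case: (l == _).
move=> m l; apply/asboolP/andP => [/linked_row_column[-> ->]|[/eqP-> /eqP->]] //.
exact/linked_row_column.
Qed.

Lemma pairing_column_row n phi v w : at_origin v -> at_origin w ->
  pairing (act_space 0 (column phi) w) (act_space 0 (row n) v) = 0.
Proof.
move=> org_v org_w; rewrite (pairing_act_origin (h := fun _ _ => 0)) //.
  (* The constant is 0, so the site (0, 0) is an arbitrary choice. *)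
  rewrite (free_ext_pick (c := 0) (k := (0, 0%N))) ?mul0r // => s _.
  rewrite mul0r.
  by rewrite (free_ext_pick (c := 0) (k := ((0, 0%N) : site))) ?mul0r // => t _;
    rewrite mul0r.
by move=> m l; apply/asboolF/linked_column_row.
Qed.

(** * Commutators, and the equations that hold on A *)

Lemma mul_elt (x y : elt) : (x * y)%g = elt_mul x y.
Proof. by []. Qed.

Lemma inv_elt (x : elt) : (x^-1)%g = elt_inv x.
Proof. by []. Qed.

Lemma conj_shift b v z :
  (shift b * base v z * (shift b)^-1)%g = base (act_space 0 b v) z.
Proof.
rewrite !mul_elt inv_elt /shift /base /elt_mul /elt_inv /=.
apply: elt_eq => //=.
- by rewrite !two_pow0 !scale1r addr0 subrr.
- by rewrite !(act_spaceVec0, oppr0, add0r, addr0).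
- by rewrite !(pairing0l, pairing0r, act_spaceVec0, oppr0, add0r, addr0).
Qed.

Lemma mul_base v w y z :
  (base v y * base w z)%g = base (v + w) (y + z + pairing v w).
Proof.
by rewrite mul_elt /base /elt_mul /= act_space0 two_pow0 scale1r !addr0.
Qed.

Lemma commutator_eq (G : groupType) (x y c : G) :
  (x * y = c * (y * x) -> x * y * x^-1 * y^-1 = c)%g.
Proof. by move=> ->; rewrite mulgA !mulgK. Qed.

(** Exchanging the factors changes the central coordinate by the form minus its transpose, which is
    a sum in characteristic 2. *)
Lemma commutator_base v w y z :
  (base v y * base w z * (base v y)^-1 * (base w z)^-1)%g
    = base 0 (pairing v w + pairing w v).
Proof.
apply: commutator_eq; rewrite (mul_base v w) (mul_base w v) mul_base pairing0l.
apply: elt_eq => //; first by rewrite add0r addrC.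
by case: y z (pairing v w) (pairing w v) => [] [] [] [].
Qed.

Lemma doubling_fixed (b : shift_module) : two_pow 1 *: b = b -> b = 0.
Proof.
move/eqP; rewrite -subr_eq0 -{2}[b]scale1r -scalerBl scaler_eq0.
by move=> /orP[//|/eqP].
Qed.

(** The exponent equation forces the dilation to be 0, since the integers are torsion-free.
    Commuting with doubling then gives 2b = b for the translation and makes the vector invariant
    under doubling. The fourth power is bracketed as [word_eval] computes it. *)
Lemma base_centralizer (x : elt) :
  (x * dilate = dilate * x)%g -> (x * (x * (x * (x * 1))) = 1)%g ->
  exists v z, x = base v z /\ at_origin v.
Proof.
case: x => j b v z; rewrite !mul_elt => comm_x x4.
have j4 : j *+ 4 = 0 by have := congr1 dilation x4; rewrite /= addr0.
have /eqP j0 : j == 0 by have := mulrn_eq0 j 4; rewrite j4 eqxx /= => <-.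
move: comm_x; rewrite j0 /elt_mul /dilate => comm_x.
have := congr1 translation comm_x; rewrite /= scaler0 addr0 add0r => b0.
have := congr1 vec comm_x; rewrite /= act_spaceVec0 addr0 add0r => fix_v.
exists v, z; split; last exact/dilate_fixed.
by rewrite /base (doubling_fixed (esym b0)).
Qed.

Local Open Scope classical_set_scope.

Lemma elementary_algebraic_commuting (G : groupType) (a : G) :
  elementary_algebraic [set x : G | x * a = a * x]%g.
Proof.
exists [:: LVar; LConst a; LVarInv; LConst (a^-1)%g].
apply/funext => x; apply/propext; rewrite /= /word_eval !big_cons big_nil /= mulg1.
split=> [xa|eq1]; first by rewrite mulgA xa -!mulgA mulVKg mulgV.
apply: (mulIg x^-1)%g; apply: (mulIg a^-1)%g.
by rewrite -[LHS]mulgA -[LHS]mulgA eq1 mulgK mulgV.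
Qed.

Lemma elementary_algebraic_exponent4 (G : groupType) :
  elementary_algebraic [set x : G | x * (x * (x * (x * 1))) = 1]%g.
Proof.
exists [:: LVar; LVar; LVar; LVar].
by apply/funext => x; rewrite /= /word_eval !big_cons big_nil.
Qed.

Lemma base_commutes v z : at_origin v ->
  (base v z * dilate = dilate * base v z)%g.
Proof.
move=> /dilate_fixed org_v; rewrite !mul_elt /elt_mul /base /dilate /=.
rewrite org_v; apply: elt_eq.
- exact: addrC.
- by rewrite !scaler0.
- by rewrite act_spaceVec0 addrC.
- by rewrite act_spaceVec0 pairing0r pairing0l addrC.
Qed.

(** As v + v = 0, the square of [base v z] lies in the subgroup {1, g} of exponent 2. *)
Lemma base_exponent4 v z :
  (base v z * (base v z * (base v z * (base v z * 1))) = 1)%g.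
Proof.
rewrite mulg1 mul_base mul_base mul_base site_spaceDD addr0 site_spaceDD.
rewrite pairing0r addr0 /base; apply: elt_eq => //=.
by case: z (pairing v v) => [] [].
Qed.

Lemma at_origin_neq0 v : at_origin v -> v <> 0 -> exists m, v@_(0, m) != 0.
Proof.
move=> org_v v0; apply: contrapT => v_vanish; apply: v0.
apply/malgP => -[p m]; rewrite mcoeff0; apply/eqP/negPn/negP => vpm.
by have /= p0 := org_v _ vpm; apply: v_vanish; exists m; rewrite -p0.
Qed.

(** * A is unconditionally closed *)

Lemma nontrivial_base_unconditionally_closed :
  unconditionally_closed nontrivial_base.
Proof.
move=> tau group_tau hausdorff_tau y cl_y.
have in_eq (E : set elt) : elementary_algebraic E ->
    nontrivial_base `<=` E -> E (y : elt).
  move=> algE subE.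
  apply: (elementary_algebraic_closed group_tau hausdorff_tau algE).
  exact: (@closureS (with_topology tau) _ _ subE _ cl_y).
have [v [z [yE org_v]]] : exists v z, (y : elt) = base v z /\ at_origin v.
  apply: base_centralizer.
    apply: (in_eq _ (elementary_algebraic_commuting dilate)).
    by move=> _ [v [z [-> org_v _]]]; exact: base_commutes.
  apply: (in_eq _ (elementary_algebraic_exponent4 elt)).
  by move=> _ [v [z [-> _ _]]]; exact: base_exponent4.
exists v, z; split=> // v0; rewrite {}v0 {org_v v} in yE.
(* Now y is 1 or g, and multiplication by y preserves A, so 1 is in the closure too. *)
have cl_1 : closure (nontrivial_base : set (with_topology tau)) (1%g : elt).
  have := closure_translate group_tau (g := (y : elt)) cl_y; rewrite mulVg.
  apply: (@closureS (with_topology tau)) => x [v [w [xE org_v v0]]].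
  exists v, (z + w); split=> //.
  apply: (mulgI (y : elt)); rewrite xE yE mul_base add0r pairing0l addr0.
  by congr base; clear; case: z w => [] [].
have g_neq1 : base 0 true <> 1%g by case.
have [P [Q [nP nQ PQ]]] := commutator_avoiding group_tau hausdorff_tau g_neq1.
have pick n : exists m, exists v z, [/\ at_origin v, v@_(0, m) != 0 &
    P (base (act_space 0 (row n) v) z)].
  have [_ [[v [w [-> org_v v0]]]]] :=
    cl_1 _ (conjugation_nbhs1 group_tau (shift (row n)) nP).
  rewrite /= conj_shift => Px.
  by have [m vm] := at_origin_neq0 org_v v0; exists m, v, w.
(* [phi] depends on P alone and handles all n at once; the n that matters is known only after Q has
   provided [w]. This is why M has a basis vector for every function. *)
have [phi phiP] := choice pick.
have [_ [[w [c [-> org_w w0]]]]] :=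
  cl_1 _ (conjugation_nbhs1 group_tau (shift (column phi)) nQ).
rewrite /= conj_shift => Qx.
have [n wn] := at_origin_neq0 org_w w0.
have [v [d [org_v vn Pv]]] := phiP n.
apply: (PQ _ _ Pv Qx); rewrite commutator_base.
apply: (congr1 (base 0)); apply: etrans (congr2 +%R
  (pairing_row_column n phi org_v org_w) (pairing_column_row n phi org_v org_w)) _.
by rewrite addr0; case: (v@_(0, phi n)) vn (w@_(0, n)) wn => [] // _ [].
Qed.

(** * Deleting a coordinate; A is not algebraic *)

Definition supported (J : seq vertex) (b : shift_module) : Prop :=
  forall i, b@_i != 0 -> i \in J.

Lemma supportedD J a b : supported J a -> supported J b -> supported J (a + b).
Proof.
move=> Ja Jb i; rewrite mcoeffD => abi.
have [/Ja //|/negPn/eqP ai0] := boolP (a@_i != 0).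
by apply: Jb; move: abi; rewrite ai0 add0r.
Qed.

Lemma supportedZ J c b : supported J b -> supported J (c *: b).
Proof. by move=> Jb i; rewrite mcoeffZ mulf_eq0 negb_or => /andP[_ /Jb]. Qed.

Lemma supportedN J b : supported J b -> supported J (- b).
Proof. by rewrite -scaleN1r; exact: supportedZ. Qed.

Definition confined_vec (J : seq vertex) (v : site_space) : Prop :=
  forall s, v@_s != 0 -> supported J s.1.

Definition confined (J : seq vertex) (x : elt) : Prop :=
  supported J (translation x) /\ confined_vec J (vec x).

Lemma confined_vecD J v w :
  confined_vec J v -> confined_vec J w -> confined_vec J (v + w).
Proof.
move=> Jv Jw s; rewrite mcoeffD => vws.
have [/Jv //|/negPn/eqP vs0] := boolP (v@_s != 0).
by apply: Jw; move: vws; rewrite vs0 add0r.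
Qed.

Lemma confined_vecN J v : confined_vec J v -> confined_vec J (- v).
Proof. by move=> Jv s; rewrite mcoeffN oppr_eq0 => /Jv. Qed.

Lemma confined_vec_act J j b v :
  supported J b -> confined_vec J v -> confined_vec J (act_space j b v).
Proof.
move=> Jb Jv s; pose t := act_site (- j) (- (two_pow (- j) *: b)) s.
have -> : s = act_site j b t.
  rewrite act_site_comp subrr scalerN scalerA -two_powD subrr two_pow0.
  by rewrite scale1r subrr act_site0.
rewrite mcoeff_act_space => /Jv Jt.
exact (supportedD (supportedZ Jt) Jb).
Qed.

Lemma confinedM J x y : confined J x -> confined J y -> confined J (x * y)%g.
Proof.
move=> [Jx Jvx] [Jy Jvy]; split.
  exact (supportedD Jx (supportedZ Jy)).
exact (confined_vecD Jvx (confined_vec_act Jx Jvy)).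
Qed.

Lemma confinedV J x : confined J x -> confined J (x^-1)%g.
Proof.
move=> [Jx Jvx].
have Jb : supported J (- (two_pow (- dilation x) *: translation x)).
  exact (supportedN (supportedZ Jx)).
by split=> //; exact (confined_vecN (confined_vec_act Jb Jvx)).
Qed.

Lemma confined1 J : confined J 1%g.
Proof. by split=> i /=; rewrite mcoeff0. Qed.

(** Second components of linked sites have the form phi n and n; freshness keeps l different from
    both when e_n and f_phi are available in [J]. *)
Definition fresh (J : seq vertex) (l : nat) : Prop :=
  forall n phi, (inl n : vertex) \in J -> (inr phi : vertex) \in J ->
    n != l /\ phi n != l.

(** The difference t.1 - s.1 is a nonzero multiple of f_phi - e_n with n = t.2, so both of these
    vertices lie in [J]. *)
Lemma linked_fresh J l s t : fresh J l ->
  supported J s.1 -> supported J t.1 -> linked s t -> s.2 != l /\ t.2 != l.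
Proof.
move=> Jl Js Jt [j [phi [eq_st ->]]].
have Jst := supportedD Jt (supportedN Js); rewrite eq_st in Jst.
have ne := two_pow_neq0 j.
have [] // := Jl t.2 phi.
- apply: Jst; rewrite mcoeffZ mcoeffB !mcoeffU eqxx /= sub0r.
  by rewrite mulrN mulr1 oppr_eq0.
- by apply: Jst; rewrite mcoeffZ mcoeffB !mcoeffU eqxx /= subr0 mulr1.
Qed.

Definition kill (l : nat) : site_space -> site_space :=
  free_ext (fun s => if s.2 == l then 0 else << s >> : site_space).
HB.instance Definition _ l := GRing.Linear.on (kill l).

Lemma mcoeff_kill l v s : (kill l v)@_s = (s.2 != l) && v@_s.
Proof.
rewrite /kill mcoeff_free_ext.
apply: (@free_ext_pick _ _ v (s.2 != l) s) => t _.
have [->|ts] := eqVneq t s.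
  by case: eqP => //= _; rewrite ?mcoeff0 ?mcoeffUU.
by case: eqP => _; rewrite ?mcoeff0 ?mcoeffU ?(negPf ts) /=; case: (_ != l).
Qed.

Lemma kill_act l j b v : kill l (act_space j b v) = act_space j b (kill l v).
Proof.
rewrite {1}/act_space free_ext_comp [in RHS]/kill free_ext_comp.
apply: eq_free_ext => s _ /=; rewrite /kill free_extU /=.
by case: (s.2 == l); [rewrite act_spaceVec0|rewrite act_spaceU].
Qed.

Lemma confined_vec_kill J l v : confined_vec J v -> confined_vec J (kill l v).
Proof.
by move=> Jv s; rewrite mcoeff_kill => vs; apply: Jv; case: (_ != l) vs.
Qed.

(** By [linked_fresh], no site with second component l is linked, in either position, to a site over
    the span of [J]. The two arguments are treated in turn, the right one first. *)
Lemma pairing_kill J l v w : fresh J l ->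
  confined_vec J v -> confined_vec J w ->
  pairing (kill l v) (kill l w) = pairing v w.
Proof.
move=> Jl Jv Jw; have Jkv := confined_vec_kill (l := l) Jv.
have -> : pairing (kill l v) (kill l w) = pairing (kill l v) w.
  apply: (eq_free_ext (W := bool^o)) => s; rewrite -mcoeff_neq0 => /Jkv Js.
  rewrite /kill (free_ext_comp (W := bool^o)).
  apply: (eq_free_ext (W := bool^o)) => t; rewrite -mcoeff_neq0 => /Jw Jt /=.
  have [tl|_] := eqVneq t.2 l; last by rewrite free_extU.
  rewrite linear0; apply/esym/asboolF => /(linked_fresh Jl Js Jt)[_].
  by rewrite tl eqxx.
rewrite /pairing /kill (free_ext_comp (W := bool^o)).
apply: (eq_free_ext (W := bool^o)) => s; rewrite -mcoeff_neq0 => /Jv Js /=.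
have [sl|_] := eqVneq s.2 l; last by rewrite free_extU.
rewrite linear0; apply/esym.
rewrite (@free_ext_pick _ _ w 0 (0, 0%N)) ?mul0r // => t.
rewrite -mcoeff_neq0 mul0r => /Jw Jt.
by apply: asboolF => /(linked_fresh Jl Js Jt)[]; rewrite sl eqxx.
Qed.

Definition retract (l : nat) (x : elt) : elt :=
  Elt (dilation x) (translation x) (kill l (vec x)) (central x).

Lemma retractM J l x y : fresh J l -> confined J x -> confined J y ->
  retract l (x * y)%g = (retract l x * retract l y)%g.
Proof.
move=> Jl [Jx Jvx] [Jy Jvy].
rewrite /retract !mul_elt /elt_mul /= -kill_act.
rewrite (pairing_kill Jl Jvx (confined_vec_act Jx Jvy)).
by apply: elt_eq; rewrite // -[RHS]linearD.
Qed.

Lemma retract1 l : retract l 1%g = 1%g.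
Proof. by rewrite /retract linear0. Qed.

Lemma retractV J l x : fresh J l -> confined J x ->
  retract l (x^-1)%g = ((retract l x)^-1)%g.
Proof.
move=> Jl Jx; apply: (mulgI (retract l x)).
by rewrite -(retractM Jl Jx (confinedV Jx)) !mulgV retract1.
Qed.

(** The default 1 is harmless: it is confined to every [J] and fixed by every [retract]. *)
Definition letter_constant (a : letter elt) : elt :=
  if a is LConst g then g else 1%g.

(** [retract l] is multiplicative only on confined elements, so the induction carries confinement
    along. *)
Lemma retract_word_eval J l (w : seq (letter elt)) x : fresh J l ->
  (forall g, g \in map letter_constant w -> confined J g /\ retract l g = g) ->
  confined J x ->
  confined J (word_eval w x) /\
  retract l (word_eval w x) = word_eval w (retract l x).
Proof.
move=> Jl; rewrite /word_eval; elim: w => [_ _|a w IHw wP Jx].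
  by rewrite !big_nil; split; [exact: confined1|exact: retract1].
have [Jw eq_w] : confined J (\prod_(b <- w) letter_eval x b)%g /\
    retract l (\prod_(b <- w) letter_eval x b)%g
      = (\prod_(b <- w) letter_eval (retract l x) b)%g.
  by apply: IHw => // g gw; apply: wP; rewrite inE gw orbT.
have [Ja eq_a] : confined J (letter_eval x a) /\
    retract l (letter_eval x a) = letter_eval (retract l x) a.
  case: a wP => [g||] wP /=.
  - by apply: wP; rewrite inE eqxx.
  - by [].
  - by split; [exact: confinedV|exact: retractV Jl Jx].
rewrite !big_cons; split; first exact: confinedM.
by rewrite (retractM Jl Ja Jw) eq_a eq_w.
Qed.

Lemma fresh_coordinate (gs : seq elt) : exists J l,
  fresh J l /\ {in gs, forall g, confined J g /\ retract l g = g}.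
Proof.
pose sites := flatten [seq enum_fset (msupp (vec g)) | g <- gs].
pose J := flatten [seq enum_fset (msupp (translation g)) | g <- gs]
  ++ flatten [seq enum_fset (msupp s.1) | s <- sites].
(* The default values 0 only enlarge the finite list [used] that l has to avoid. *)
pose index (i : vertex) := if i is inl n then n else 0%N.
pose value (i k : vertex) := if i is inr phi then phi (index k) else 0%N.
(* The first two lists make l fresh for [J]; the third ensures that deleting coordinate l fixes
   every g in [gs]. *)
pose used := map index J ++ [seq value i k | i <- J, k <- J] ++ map snd sites.
pose l := (\max_(m <- used) m).+1.
have lP m : m \in used -> m != l.
  by move=> mu; rewrite neq_ltn ltnS (leq_bigmax_seq (F := id)).
exists J, l; split=> [n phi Jn Jphi|g g_gs].
  split; apply: lP; rewrite !mem_cat; apply/orP; [left|right].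
    by apply/mapP; exists (inl n).
  by apply/orP; left; apply/allpairsP; exists (inr phi, inl n).
have in_sites s : (vec g)@_s != 0 -> s \in sites.
  by rewrite mcoeff_neq0 => gs_s; apply/flatten_mapP; exists g.
split; [split=> [i|s /in_sites s_sites i]|].
- rewrite mcoeff_neq0 mem_cat => gi; apply/orP; left.
  by apply/flatten_mapP; exists g.
- rewrite mcoeff_neq0 mem_cat => si; apply/orP; right.
  by apply/flatten_mapP; exists s.
case: g g_gs in_sites => j b v z _ /= in_sites; apply: elt_eq => //=.
apply/malgP => s; rewrite mcoeff_kill.
have [/in_sites s_sites|/negPn/eqP ->] := boolP (v@_s != 0); last exact: andbF.
suff -> : s.2 != l by [].
by apply: lP; rewrite !mem_cat map_f ?orbT.
Qed.

Lemma nontrivial_base_not_algebraic : ~ algebraic nontrivial_base.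
Proof.
move=> [F [algF defA]].
have notA1 : ~ nontrivial_base 1%g.
  by move=> [v [z [/(congr1 vec) /= <- _]]]; exact.
(* Since 1 is not in A, some additively algebraic set containing A omits 1. *)
have [D FD notD1] : exists2 D, F D & ~ D 1%g.
  apply: contrapT => noD; apply: notA1; rewrite defA => D FD.
  by apply: contrapT => nD1; apply: noD; exists D.
have subD : nontrivial_base `<=` D by rewrite defA => x; apply.
have [E [finE elemE defD]] := algF _ FD.
have [s defE] : exists s : seq (set elt), E = [set` s] by exact/finite_seqP.
have /choice[W WP] : forall B, exists w : seq (letter elt),
    E B -> B = [set x | word_eval w x = 1%g].
  move=> B; have [EB|nEB] := pselect (E B); last by exists [::].
  by have [w defB] := elemE _ EB; exists w.
have [J [l [Jl gsP]]] := fresh_coordinate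
  (flatten [seq map letter_constant (W B) | B <- s]).
(* This vector lies over 0, hence is confined to any [J], and it is removed by [kill l]. *)
pose v : site_space := << (0, l) >>.
have v_coeff t : v@_t != 0 -> t = (0, l).
  by rewrite mcoeffU; have [eq_t|] := eqVneq (0, l) t; first rewrite -eq_t.
have org_v : at_origin v by move=> t /v_coeff ->.
have v0 : v <> 0 by move/eqP; rewrite monalgU_eq0.
have : D (base v 0) by apply: subD; exists v, 0.
rewrite defD => -[B EB]; rewrite (WP _ EB) /= => eq1.
have Jx : confined J (base v 0).
  by split=> [i|t /v_coeff -> i] /=; rewrite mcoeff0.
have x1 : retract l (base v 0) = 1%g.
  by apply: elt_eq => //=; rewrite /kill free_extU /= eqxx.
have [g g_B|_ eq2] := retract_word_eval (w := W B) Jl _ Jx.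
  apply: gsP; apply/flatten_mapP; exists B => //.
  by move: EB; rewrite defE.
(* Applying [retract l] to w(x) = 1 gives w(1) = 1, which puts 1 in [B] and so in [D]. *)
apply: notD1; rewrite defD; exists B => //; rewrite (WP _ EB) /=.
by rewrite -x1 -eq2 eq1 retract1.
Qed.

Theorem mainTheorem1 :
  continuum_hypothesis ->
  exists (G : groupType) (A : set G),
    unconditionally_closed A /\ ~ algebraic A.
Proof.
move=> _; exists elt, nontrivial_base; split.
  exact: nontrivial_base_unconditionally_closed.
exact: nontrivial_base_not_algebraic.
Qed.
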